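(* Let $\nabla$ be an affine connection (possibly with torsion) on a smooth manifold $\mathcal{M}$, and let $\nabla^{\star}$ be the connection whose coefficients are $\Gamma^{\star\, i}{}_{kj}=\Gamma^{i}{}_{jk}$ in local coordinates. Then, given two vectors, the parallel transport of one in the direction of the other using $\nabla$, and of the other in the direction of the first using $\nabla^{\star}$, preserves the vectors from twisting. That is: let $x^i(\lambda)$ and $\tilde{x}^i(\lambda)$ be smooth curves in a coordinate chart starting at the same point at $\lambda=0$, with tangent vectors $u^i=\frac{dx^i}{d\lambda}(0)$ and $\tilde{u}^i=\frac{d\tilde{x}^i}{d\lambda}(0)$. Let $u'^i$ be the components of the vector obtained by parallel transporting $u$ with respect to $\nabla$ along $\tilde{x}$ from $\lambda=0$ to $\lambda=\delta\lambda$, and let $\tilde{u}'^i$ be the components of the vector obtained by parallel transporting $\tilde{u}$ with respect to $\nabla^{\star}$ along $x$ from $\lambda=0$ to $\lambda=\delta\lambda$. Then $$(\tilde{u}^i+u'^i)-(u^i+\tilde{u}'^i)=\mathcal{O}(\delta\lambda^2)\qquad\text{as }\delta\lambda\to0,$$ i.e. the deviation vanishes to first order in $\delta\lambda$.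
   Context: Connection coefficients are defined by $\nabla_{\partial_i}\partial_j=\Gamma^{k}{}_{ji}\partial_k$ (note the index order), so that a vector field $v^i(\lambda)$ along a curve $y^i(\lambda)$ is parallel with respect to $\nabla$ if $\frac{dv^i}{d\lambda}+\Gamma^{i}{}_{jk}\,v^j\frac{dy^k}{d\lambda}=0$; likewise for $\nabla^{\star}$ with coefficients $\Gamma^{\star\, i}{}_{jk}$. The quantity $(\tilde{u}^i+u'^i)-(u^i+\tilde{u}'^i)$ measures, to first order in $\delta\lambda$, the failure of the infinitesimal parallelogram built from $u$ and $\tilde u$ to close (''twisting''). *)

(* Defs.v *)
From HB Require Import structures.
From mathcomp Require Import all_boot all_order all_algebra.
From mathcomp Require Import all_classical all_reals all_analysis.

Set Implicit Arguments.
Unset Strict Implicit.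
Unset Printing Implicit Defensive.

Import Order.TTheory GRing.Theory Num.Theory.
Import numFieldNormedType.Exports.

Local Open Scope ring_scope.
Local Open Scope classical_set_scope.

(* Only used on open U, where 'D_v f at a point of U depends on f in U only;
   f may take arbitrary values outside U. *)
Fixpoint Ck_on (R : realType) (V W : normedModType R) (k : nat) (U : set V)
    (f : V -> W) : Prop :=
  match k with
  | 0 => forall x, U x -> {for x, continuous f}
  | k'.+1 => (forall x, U x -> differentiable f x) /\
             (forall v : V, Ck_on k' U ('D_v f))
  end.

Definition smooth_on (R : realType) (V W : normedModType R) (U : set V)
    (f : V -> W) : Prop :=
  forall k, Ck_on k U f.

(* chart_coord is only meaningful on chart_dom, and its inverse chart_pt only
   on the image of chart_dom. *)
Record chart (R : realType) (n : nat) (M : topologicalType) := Chart {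
  chart_dom : set M ;
  chart_coord : M -> 'rV[R]_n ;
  chart_pt : 'rV[R]_n -> M ;
  chart_dom_open : open chart_dom ;
  chart_img_open : open (chart_coord @` chart_dom) ;
  chart_coordK : forall p, chart_dom p -> chart_pt (chart_coord p) = p ;
  chart_coord_cont : forall p, chart_dom p -> {for p, continuous chart_coord} ;
  chart_pt_cont : forall y, (chart_coord @` chart_dom) y ->
    {for y, continuous chart_pt}
}.

Definition transition (R : realType) (n : nat) (M : topologicalType)
    (c c' : chart R n M) : 'rV[R]_n -> 'rV[R]_n :=
  chart_coord c' \o chart_pt c.

Definition charts_compatible (R : realType) (n : nat) (M : topologicalType)
    (c c' : chart R n M) : Prop :=
  smooth_on (chart_coord c @` (chart_dom c `&` chart_dom c'))
            (transition c c').

Record smooth_manifold (R : realType) (n : nat) := SmoothManifold {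
  carrier :> topologicalType ;
  atlas : set (chart R n carrier) ;
  manifold_hausdorff : hausdorff_space carrier ;
  manifold_second_countable : @second_countable carrier ;
  atlas_cover : forall p : carrier, exists2 c, atlas c & chart_dom c p ;
  atlas_compatible : forall c c', atlas c -> atlas c' -> charts_compatible c c' ;
  atlas_maximal : forall c,
    (forall c', atlas c' -> charts_compatible c c' /\ charts_compatible c' c) ->
    atlas c
}.

(* Smoothness is tested in one chart around each point, which is enough since
   transition maps are smooth. *)
Definition smooth_function (R : realType) (n : nat) (M : smooth_manifold R n)
    (W : set M) (f : M -> R) : Prop :=
  forall p, W p -> exists c, [/\ atlas c, chart_dom c p &
    smooth_on (chart_coord c @` (chart_dom c `&` W)) (f \o chart_pt c)].

(* A tangent vector at p is given by its components in every chart around p,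
   related by the Jacobians of the transition maps: X c p is the row of
   components X^i(p) in the chart c.  Values at c outside the atlas or at p
   outside chart_dom c are irrelevant. *)
Definition components (R : realType) (n : nat) (M : smooth_manifold R n) :=
  chart R n M -> M -> 'rV[R]_n.

Definition vector_field (R : realType) (n : nat) (M : smooth_manifold R n)
    (W : set M) (X : components M) : Prop :=
  (forall c c' p, atlas c -> atlas c' -> chart_dom c p -> chart_dom c' p ->
    W p -> X c' p = 'D_(X c p) (transition c c') (chart_coord c p)) /\
  (forall p, W p -> exists c, [/\ atlas c, chart_dom c p &
    smooth_on (chart_coord c @` (chart_dom c `&` W)) (X c \o chart_pt c)]).

Definition vf_eq_on (R : realType) (n : nat) (M : smooth_manifold R n)
    (W : set M) (X Y : components M) : Prop :=
  forall c p, atlas c -> chart_dom c p -> W p -> X c p = Y c p.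

(* The field \partial_i of the chart c, defined on chart_dom c. *)
Definition coord_field (R : realType) (n : nat) (M : smooth_manifold R n)
    (c : chart R n M) (i : 'I_n) : components M :=
  fun c' p => 'D_(delta_mx 0 i) (transition c c') (chart_coord c p).

(* nabla W X Y is \nabla_X Y for vector fields X and Y on the open set W. The
   operators on the various open sets commute with restriction, so that
   \nabla can be applied to coordinate fields, which are only local.  In the
   Leibniz rule, the derivative X(f) is computed in the chart c. *)
Record connection (R : realType) (n : nat) (M : smooth_manifold R n) :=
    Connection {
  nabla : set M -> components M -> components M -> components M ;
  nabla_vector_field : forall W X Y, open W ->
    vector_field W X -> vector_field W Y -> vector_field W (nabla W X Y) ;
  nabla_local : forall W W' X X' Y Y', open W -> open W' -> W' `<=` W ->
    vector_field W X -> vector_field W Y ->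
    vector_field W' X' -> vector_field W' Y' ->
    vf_eq_on W' X X' -> vf_eq_on W' Y Y' ->
    vf_eq_on W' (nabla W X Y) (nabla W' X' Y') ;
  nabla_linear : forall W f X X' Y, open W -> smooth_function W f ->
    vector_field W X -> vector_field W X' -> vector_field W Y ->
    vf_eq_on W (nabla W (fun c p => f p *: X c p + X' c p) Y)
               (fun c p => f p *: nabla W X Y c p + nabla W X' Y c p) ;
  nabla_additive : forall W X Y Y', open W ->
    vector_field W X -> vector_field W Y -> vector_field W Y' ->
    vf_eq_on W (nabla W X (fun c p => Y c p + Y' c p))
               (fun c p => nabla W X Y c p + nabla W X Y' c p) ;
  nabla_leibniz : forall W f X Y, open W -> smooth_function W f ->
    vector_field W X -> vector_field W Y ->
    vf_eq_on W (nabla W X (fun c p => f p *: Y c p))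
               (fun c p => 'D_(X c p) (f \o chart_pt c) (chart_coord c p)
                             *: Y c p + f p *: nabla W X Y c p)
}.

(* Index order: \nabla_{\partial_i} \partial_j = Gamma^k_{j i} \partial_k,
   the differentiating direction being the last lower index. *)
Definition Gamma (R : realType) (n : nat) (M : smooth_manifold R n)
    (D : connection M) (c : chart R n M) (k j i : 'I_n) (p : M) : R :=
  nabla D (chart_dom c) (coord_field c i) (coord_field c j) c p 0 k.

Definition transposed_connection (R : realType) (n : nat)
    (M : smooth_manifold R n) (D Dstar : connection M) : Prop :=
  forall (c : chart R n M) (p : M) (i j k : 'I_n), atlas c -> chart_dom c p ->
    Gamma Dstar c i k j p = Gamma D c i j k p.

Definition smooth_curve_in (R : realType) (n : nat) (M : smooth_manifold R n)
    (c : chart R n M) (I : set R) (x : R -> M) : Prop :=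
  [/\ open I, is_interval I, (forall t, I t -> chart_dom c (x t)) &
      smooth_on I (chart_coord c \o x)].

Definition velocity (R : realType) (n : nat) (M : smooth_manifold R n)
    (c : chart R n M) (x : R -> M) (t : R) : 'rV[R]_n :=
  \row_i derive1 (fun s => chart_coord c (x s) 0 i) t.

(* Both orders of a and b are allowed. *)
Definition parallel_along (R : realType) (n : nat) (M : smooth_manifold R n)
    (D : connection M) (c : chart R n M) (y : R -> M) (a b : R)
    (v : R -> 'rV[R]_n) : Prop :=
  forall t, Num.min a b <= t <= Num.max a b -> forall i : 'I_n,
    derivable (fun s => v s 0 i) t 1 /\
    derive1 (fun s => v s 0 i) t
      + \sum_(j < n) \sum_(k < n)
          Gamma D c i j k (y t) * v t 0 j * velocity c y t 0 k = 0.

(* w is the result of parallel transporting the vector v along y, from the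
   parameter value a to the parameter value b (components in the chart c). *)
Definition parallel_transport (R : realType) (n : nat)
    (M : smooth_manifold R n) (D : connection M) (c : chart R n M)
    (y : R -> M) (a b : R) (v w : 'rV[R]_n) : Prop :=
  exists V : R -> 'rV[R]_n, [/\ parallel_along D c y a b V, V a = v & V b = w].

(* Main.v *)
Require Import Defs.
From mathcomp Require Import ring lra.
From HB Require Import structures.
From mathcomp Require Import all_boot all_order all_algebra.
From mathcomp Require Import all_classical all_reals all_analysis.

Set Implicit Arguments.
Unset Strict Implicit.
Unset Printing Implicit Defensive.

Import Order.TTheory GRing.Theory Num.Theory.
Import numFieldNormedType.Exports.

Local Open Scope ring_scope.
Local Open Scope classical_set_scope.

(** In the coordinates of [c], parallel transport along a curve [y] is the
    linear equation [V' + A V = 0], where the entry [i, j] of the matrix [A t]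
    is the sum over [k] of [Gamma^i_{jk} (y t) * y'^k t].  If [A] is
    differentiable at 0, the solution that starts at [v] satisfies
    [V d = v - d * (A 0 v) + O(d^2)] ([parallel_transport_first_order]).
    Transporting [u] along [xt] with [D] therefore changes [u^i] by
    [- d * Gamma^i_{jk} u^j ut^k], and transporting [ut] along [x] with [Dstar]
    changes [ut^i] by [- d * Gammastar^i_{jk} ut^j u^k].  The coefficients are
    taken at the common starting point, so transposition of the lower indices
    makes the two first-order terms equal, and only [O(d^2)] remains.

    Two points need work.

    The transported vector is only given, for each [d], as the endpoint of some
    solution on the segment from 0 to [d], and this solution may change with
    [d]; the estimate has to be uniform over all of them.  For small [d] the
    mean value inequality, applied at a point where the norm of the solution is
    maximal, bounds every such solution by twice its initial norm
    ([linear_ode_a_priori]).  A second use of it shows that the solution stays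
    within [O(d)] of [v], and a third gives the expansion
    ([linear_ode_first_order]).

    The Christoffel symbols must be differentiable along a curve.  They are
    components of the covariant derivative of coordinate fields, so it must be
    shown that these are vector fields in the first place
    ([coord_field_vector_field], from the chain rule for transition maps).
    The derivative is then a vector field as well, but its components are known
    to be smooth only in some chart [c'] around the given point.  The
    transformation law expresses the components in [c] as sums of products of
    those in [c'] with partial derivatives of the transition map
    ([vector_field_derivable]). *)

(** * Differentiability is a local property *)

(** The first-order expansion of [f] at [x] is also one of [g]. *)
Lemma near_eq_differentiable (R : numFieldType) (V W : normedModType R)
    (f g : V -> W) (x : V) :
  (\forall y \near x, f y = g y) -> differentiable f x -> differentiable g x.
Proof.
move=> fg df; have fgx := nbhs_singleton fg.
have expand : g \o shift x = cst (g x) + 'd f x +o_ 0 id.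
  apply/eqaddoP => e e0.
  have /eqaddoP/(_ e e0) := diff_locally df.
  have : \forall h \near (0 : V), f (h + x) = g (h + x).
    have := fg; rewrite (near_shift 0 x) subr0.
    by apply: filterS.
  by apply: filterS2 => h /= fgh; rewrite !fctE /= -fgh -fgx.
apply/diff_locallyP; rewrite (diff_unique (diff_continuous df) expand).
by split=> //; exact: diff_continuous.
Qed.

Lemma smooth_on_constant (R : realType) (V W : normedModType R) (U : set V)
    (f : V -> W) (a : W) :
  open U -> (forall x, U x -> f x = a) -> smooth_on U f.
Proof.
move=> oU hf k.
have near_cst (g : V -> W) (b : W) x : (forall y, U y -> g y = b) -> U x ->
    \forall y \near x, cst b y = g y.
  by move=> hg Ux; apply: filterS (open_nbhs_nbhs (conj oU Ux)) => y /hg.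
elim: k f a hf => [|k IH] f a hf /=.
  move=> x Ux; apply: differentiable_continuous.
  exact: near_eq_differentiable (near_cst f a x hf Ux) (differentiable_cst _ _).
split=> [x Ux|v].
  exact: near_eq_differentiable (near_cst f a x hf Ux) (differentiable_cst _ _).
apply: (IH _ 0) => x Ux.
by rewrite -(near_eq_derive v (near_cst f a x hf Ux)) derive_cst.
Qed.

(** * Charts, transition maps and coordinate fields *)

Lemma chart_pt_near (R : realType) (n : nat) (M : topologicalType)
    (c : chart R n M) (W : set M) (p : M) :
  chart_dom c p -> open W -> W p ->
  \forall y \near chart_coord c p, W (chart_pt c y).
Proof.
move=> cp oW Wp.
have img_p : (chart_coord c @` chart_dom c) (chart_coord c p) by exists p.
apply: (chart_pt_cont img_p).
by rewrite chart_coordK//; exact: open_nbhs_nbhs.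
Qed.

Lemma transitionK (R : realType) (n : nat) (M : topologicalType)
    (c c' : chart R n M) (p : M) :
  chart_dom c p -> transition c c' (chart_coord c p) = chart_coord c' p.
Proof. by move=> cp; rewrite /transition/= chart_coordK. Qed.

Lemma transition_differentiable (R : realType) (n : nat) (M : smooth_manifold R n)
    (c c' : chart R n M) (p : M) :
  atlas c -> atlas c' -> chart_dom c p -> chart_dom c' p ->
  differentiable (transition c c') (chart_coord c p).
Proof.
move=> ac ac' cp c'p; have [+ _] := atlas_compatible ac ac' 1.
by apply; exists p.
Qed.

(** The chain rule, since the transition map from [c] to [c''] factors through
    [c'] near [p].  This is the transformation law of coordinate fields. *)
Lemma derive_transition_cocycle (R : realType) (n : nat) (M : smooth_manifold R n)
    (c c' c'' : chart R n M) (p : M) (v : 'rV[R]_n) :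
  atlas c -> atlas c' -> atlas c'' ->
  chart_dom c p -> chart_dom c' p -> chart_dom c'' p ->
  'D_v (transition c c'') (chart_coord c p) =
  'D_('D_v (transition c c') (chart_coord c p))
     (transition c' c'') (chart_coord c' p).
Proof.
move=> ac ac' ac'' cp c'p c''p.
have d1 := transition_differentiable ac ac' cp c'p.
have d2 := transition_differentiable ac' ac'' c'p c''p.
transitivity ('D_v (transition c' c'' \o transition c c') (chart_coord c p)).
  apply: near_eq_derive.
  apply: filterS (chart_pt_near cp (chart_dom_open c') c'p) => y c'y /=.
  by rewrite /transition/= chart_coordK.
rewrite deriveE; last first.
  by apply: differentiable_comp; rewrite ?transitionK.
by rewrite diff_comp ?transitionK//= !deriveE.
Qed.

Lemma coord_field_self (R : realType) (n : nat) (M : smooth_manifold R n)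
    (c : chart R n M) (i : 'I_n) (p : M) :
  chart_dom c p -> coord_field c i c p = delta_mx 0 i.
Proof.
move=> cp; rewrite /coord_field.
rewrite -[RHS](derive_id (chart_coord c p)); apply: near_eq_derive.
have img_p : (chart_coord c @` chart_dom c) (chart_coord c p) by exists p.
apply: filterS (open_nbhs_nbhs (conj (@chart_img_open _ _ _ c) img_p)).
by move=> _ [q cq <-]; rewrite transitionK.
Qed.

(** The topology of the source only enters through coordinates: [y] itself is
    recovered near [t] by applying the continuous inverse chart. *)
Lemma near_along_map (R : realType) (n : nat) (M : topologicalType)
    (c : chart R n M) (U : set M) (T : topologicalType) (y : T -> M) (t : T) :
  (\forall s \near t, chart_dom c (y s)) ->
  {for t, continuous (chart_coord c \o y)} ->
  open U -> U (y t) -> \forall s \near t, U (y s).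
Proof.
move=> cy ycont oU Uyt.
have /ycont := chart_pt_near (nbhs_singleton cy) oU Uyt.
by apply: filterS2 cy => s cys /=; rewrite chart_coordK.
Qed.

Lemma coord_field_vector_field (R : realType) (n : nat) (M : smooth_manifold R n)
    (c : chart R n M) (i : 'I_n) :
  atlas c -> vector_field (chart_dom c) (coord_field c i : components M).
Proof.
move=> ac; split=> [c' c'' p ac' ac'' c'p c''p cp|p cp].
  exact: derive_transition_cocycle.
exists c; split=> //; rewrite setIid.
apply: (smooth_on_constant (a := delta_mx 0 i)); first exact: chart_img_open.
by move=> _ [q cq <-] /=; rewrite chart_coordK// coord_field_self.
Qed.

(** * Differentiability of vector fields and velocities along a curve *)

Lemma derive_sum_delta (R : realType) (n : nat) (W : normedModType R)
    (f : 'rV[R]_n -> W) (x v : 'rV[R]_n) :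
  differentiable f x ->
  'D_v f x = \sum_(k < n) v 0 k *: 'D_(delta_mx 0 k) f x.
Proof.
move=> df; rewrite [in LHS](row_sum_delta v) deriveE// linear_sum.
by apply: eq_bigr => k _; rewrite linearZ deriveE.
Qed.

Lemma derivable_comp_entry (R : realType) (n m : nat)
    (f : 'rV[R]_n -> 'rV[R]_m) (q : R -> 'rV[R]_n) (t : R) (k : 'I_m) :
  differentiable q t -> differentiable f (q t) ->
  derivable (fun s => f (q s) 0 k) t 1.
Proof.
move=> dq df; have : derivable (f \o q) t 1.
  by apply/derivable1_diffP; exact: differentiable_comp.
by move=> /derivable_mxP; exact.
Qed.

(** Smoothness of [X] is available only in the chart [c'] supplied by the
    definition, so [X c] is rewritten near [t] by the transformation law from
    [c'] to [c]; everything on the right-hand side of the law is differentiable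
    in the coordinates of [c']. *)
Lemma vector_field_derivable (R : realType) (n : nat) (M : smooth_manifold R n)
    (c : chart R n M) (W : set M) (X : components M) (y : R -> M)
    (t : R) (i : 'I_n) :
  atlas c -> open W -> vector_field W X -> W (y t) ->
  (\forall s \near t, chart_dom c (y s)) ->
  differentiable (chart_coord c \o y) t ->
  derivable (fun s => X c (y s) 0 i) t 1.
Proof.
move=> ac oW [X_law X_smooth] Wyt cy dy.
have cyt := nbhs_singleton cy.
have [c' [ac' c'yt Xc'_smooth]] := X_smooth _ Wyt.
have yc := differentiable_continuous dy.
have near_c' := near_along_map cy yc (chart_dom_open c') c'yt.
have near_W := near_along_map cy yc oW Wyt.
(* The curve [y] read in the chart [c']. *)
pose q := transition c c' \o (chart_coord c \o y).
have dq : differentiable q t.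
  by apply: differentiable_comp => //; exact: transition_differentiable.
have qE s : chart_dom c (y s) -> q s = chart_coord c' (y s).
  by move=> cys; rewrite /q/= transitionK.
have dX : differentiable (X c' \o chart_pt c') (q t).
  by have [+ _] := Xc'_smooth 1; apply; rewrite qE//; exists (y t).
have dT k : differentiable ('D_(delta_mx 0 k) (transition c' c)) (q t).
  have [_ /(_ (delta_mx 0 k))[+ _]] := atlas_compatible ac' ac 2.
  by apply; rewrite qE//; exists (y t).
pose h (k : 'I_n) (s : R) : R := (X c' \o chart_pt c') (q s) 0 k *
    'D_(delta_mx 0 k) (transition c' c) (q s) 0 i.
have dh k : derivable (h k) t 1.
  have dXk := derivable_comp_entry (k := k) dq dX.
  have dTk := derivable_comp_entry (k := i) dq (dT k).
  exact: (derivableM dXk dTk).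
apply: near_eq_derivable (derivable_sum dh).
near=> s.
have cys : chart_dom c (y s) by near: s.
have c'ys : chart_dom c' (y s) by near: s.
have Ws : W (y s) by near: s.
rewrite (X_law c' c)// derive_sum_delta; last exact: transition_differentiable.
rewrite summxE fct_sumE; apply: eq_bigr => k _.
by rewrite mxE /h qE//= chart_coordK.
Unshelve. all: by end_near. Qed.

Lemma smooth_curve_coord_differentiable (R : realType) (n : nat)
    (M : smooth_manifold R n) (c : chart R n M) (I : set R) (y : R -> M) (t : R) :
  smooth_curve_in c I y -> I t -> differentiable (chart_coord c \o y) t.
Proof. by move=> [_ _ _ ys]; have [+ _] := ys 1; apply. Qed.

(** The entries of the velocity are those of the derivative of the coordinate
    map of the curve, which is again differentiable. *)
Lemma velocity_derivable (R : realType) (n : nat)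
    (M : smooth_manifold R n) (c : chart R n M) (I : set R) (y : R -> M) (t : R)
    (k : 'I_n) :
  smooth_curve_in c I y -> I t -> derivable (fun s => velocity c y s 0 k) t 1.
Proof.
move=> hy It; have [oI _ _ ys] := hy.
have [_ /(_ 1)[d2 _]] := ys 2.
have /derivable1_diffP/derivable_mxP/(_ 0 k) := d2 t It.
apply: near_eq_derivable.
apply: filterS (open_nbhs_nbhs (conj oI It)) => s Is.
have /derivable1_diffP ds := smooth_curve_coord_differentiable hy Is.
by rewrite derive_mx// !mxE derive1E.
Qed.

(** * First-order expansion of solutions of a linear equation *)

Lemma between_norm (R : realType) (t d : R) :
  Num.min 0 d <= t <= Num.max 0 d -> `|t| <= `|d|.
Proof.
case: (leP 0 d) => d0 /andP[h1 h2].
  by rewrite !ger0_norm.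
by rewrite !ler0_norm ?lerN2 // ltW.
Qed.

Lemma between_trans (R : realType) (s t d : R) :
  Num.min 0 d <= t <= Num.max 0 d ->
  Num.min 0 t <= s <= Num.max 0 t -> Num.min 0 d <= s <= Num.max 0 d.
Proof.
case: (leP 0 d) => d0 /andP[h1 h2]; case: (leP 0 t) => t0 /andP[k1 k2];
 apply/andP; split; lra.
Qed.

(** The mean value inequality for [f t - m * t], for a segment traversed in
    either direction. *)
Lemma mean_value_deviation (R : realType) (f : R -> R) (a b m C : R) :
  (forall t, Num.min a b <= t <= Num.max a b ->
     derivable f t 1 /\ `|f^`()%classic t - m| <= C) ->
  `|f b - f a - m * (b - a)| <= C * `|b - a|.
Proof.
wlog ab : a b / a <= b => [hw|].
  move=> h; case: (leP a b) => [/hw|/ltW ba]; first exact.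
  rewrite -normrN (distrC b a).
  have -> : - (f b - f a - m * (b - a)) = f a - f b - m * (a - b) by ring.
  by apply: hw => // t; rewrite minC maxC; exact: h.
rewrite (min_idPl ab) (max_idPr ab) => h.
have [t | |t tab ->] := @MVT_segment R f (f^`()%classic) a b ab.
- move=> /[!in_itv]/= /andP[at_ tb]; rewrite derive1E; apply: derivableP.
  by apply: (h t _).1; rewrite !ltW.
- by apply: derivable_within_continuous => t /[!in_itv]/= /h[].
rewrite -mulrBl normrM; apply: ler_wpM2r => //.
by apply: (h t _).2; move: tab; rewrite in_itv.
Qed.

Definition linear_ode_solution (R : realType) (n : nat) (A : R -> 'M[R]_n)
    (d : R) (V : R -> 'rV[R]_n) : Prop :=
  forall t, Num.min 0 d <= t <= Num.max 0 d -> forall i : 'I_n,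
    derivable (fun s => V s 0 i) t 1 /\
    derive1 (fun s => V s 0 i) t + \sum_(j < n) A t i j * V t 0 j = 0.

Definition norm1 (R : realType) (n : nat) (v : 'rV[R]_n) : R :=
  \sum_(j < n) `|v 0 j|.

Lemma ler_sum_const (R : realType) (n : nat) (F : 'I_n -> R) (C : R) :
  (forall i, F i <= C) -> \sum_(i < n) F i <= n%:R * C.
Proof.
move=> h; apply: le_trans (ler_sum _ (fun i _ => h i)) _.
by rewrite sumr_const card_ord mulr_natl.
Qed.

Lemma norm_sum_mul_le (R : realType) (n : nat) (a v : 'I_n -> R) (K : R) :
  0 <= K -> (forall j, `|a j| <= K) ->
  `|\sum_(j < n) a j * v j| <= K * \sum_(j < n) `|v j|.
Proof.
move=> K0 h; rewrite mulr_sumr.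
apply: le_trans (ler_norm_sum _ _ _) _; apply: ler_sum => j _.
by rewrite normrM ler_wpM2r.
Qed.

(** Let [N] be the maximum of [norm1 (V t)] over the segment, attained at
    [tm].  Each component has slope at most [K * N], so
    [N <= norm1 (V 0) + n * K * |d| * N], and the last term is at most [N / 2]
    when [d] is small.  The bound depends on [V] through [V 0] only, as is
    needed when the solution varies with [d]. *)
Lemma linear_ode_a_priori (R : realType) (n : nat) (A : R -> 'M[R]_n)
    (d K : R) (V : R -> 'rV[R]_n) :
  0 <= K -> 2 * (n%:R * K) * `|d| <= 1 ->
  (forall t, `|t| <= `|d| -> forall i j, `|A t i j| <= K) ->
  linear_ode_solution A d V ->
  forall t, Num.min 0 d <= t <= Num.max 0 d -> norm1 (V t) <= 2 * norm1 (V 0).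
Proof.
move=> K0 small hA sol.
have led : Num.min 0 d <= Num.max 0 d by rewrite ge_min !le_max lexx.
have [|tm /[!in_itv]/= tm_in tm_max] :=
  @EVT_max R (fun t => norm1 (V t)) _ _ led.
  apply: continuous_in_subspaceT => t /set_mem /= /[!in_itv]/= ht.
  apply: cvg_big => [|j _]; first exact: add_continuous.
  apply: cvg_norm; apply: differentiable_continuous.
  by apply/derivable1_diffP; exact: (sol t ht j).1.
move=> t t_in; apply: (le_trans (tm_max t _)); first by rewrite in_itv.
set N := norm1 (V tm) in tm_max *.
have N0 : 0 <= N by exact: sumr_ge0.
have hj j : `|V tm 0 j| - `|V 0 0 j| <= K * N * `|d|.
  have dev : `|V tm 0 j - V 0 0 j - 0 * (tm - 0)| <= K * N * `|tm - 0|.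
    apply: (mean_value_deviation (f := fun s => V s 0 j)) => s hs.
    have s_in := between_trans tm_in hs.
    have [dV eqV] := sol s s_in j; split => //.
    rewrite subr0 -normrN (addr0_eq eqV).
    apply: le_trans (norm_sum_mul_le _ K0 _) _ => [k|].
      by apply: hA; exact: between_norm.
    apply: ler_wpM2l => //.
    by apply: tm_max; rewrite in_itv.
  apply: le_trans (lerB_dist _ _) _.
  rewrite mul0r !subr0 in dev; apply: (le_trans dev).
  by rewrite ler_wpM2l ?mulr_ge0 ?between_norm.
have : N - norm1 (V 0) <= n%:R * (K * N * `|d|).
  by rewrite /N /norm1 -sumrB; exact: ler_sum_const.
have : 2 * (n%:R * K) * `|d| * N <= 1 * N by rewrite ler_wpM2r.
nra.
Qed.

Lemma le_entry_norm (R : realType) (m n : nat) (B : 'M[R]_(m, n)) i j :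
  `|B i j| <= `|B|.
Proof.
rewrite [leRHS]mx_normrE.
exact: (le_bigmax _ (fun ij : 'I_m * 'I_n => `|B ij.1 ij.2|) (i, j)).
Qed.

(** Near [a] the difference quotient stays within 1 of its limit, so the limit
    norm plus 1 is a Lipschitz constant at [a]. *)
Lemma derivable_lipschitz_at (R : realType) (W : normedModType R) (f : R -> W)
    (a : R) :
  derivable f a 1 ->
  exists L : R, \forall t \near a, `|f t - f a| <= L * `|t - a|.
Proof.
move=> /cvg_ex[/= l /cvgrPdist_le/(_ 1 ltr01)[r /= r0 hr]].
exists (`|l| + 1); exists r => //= t /=.
rewrite distrC => tr; have [->|ta] := eqVneq t a.
  by rewrite !subrr !normr0 mulr0.
have ta0 : t - a != 0 by rewrite subr_eq0.
have := hr (t - a); rewrite /= sub0r normrN => /(_ tr ta0).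
rewrite [_%:A]mulr1 subrK => h.
have -> : f t - f a = (t - a) *: ((t - a)^-1 *: (f t - f a)).
  by rewrite scalerA divff// scale1r.
rewrite normrZ mulrC ler_wpM2r//.
rewrite -[X in `|X|](subrKC l).
apply: le_trans (ler_normD _ _) _; rewrite lerD2l.
by rewrite distrC.
Qed.

(** The constant [C] is chosen before [d] and [V].  By the a priori bound, [V]
    moves away from [v] by [O(d)] on the segment, and [A] moves away from [A 0]
    by [O(d)]; hence [V'] differs from [- A 0 v] by [O(d)], and integrating over
    a segment of length [|d|] gives an error [O(d^2)]. *)
Lemma linear_ode_first_order (R : realType) (n : nat) (A : R -> 'M[R]_n)
    (v : 'rV[R]_n) :
  derivable A 0 1 ->
  exists C : R, \forall d \near (0 : R), forall V : R -> 'rV[R]_n,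
    V 0 = v -> linear_ode_solution A d V ->
    forall i, `|V d 0 i - v 0 i + d * \sum_(j < n) A 0 i j * v 0 j| <= C * d ^+ 2.
Proof.
move=> /derivable_lipschitz_at[L' hL'].
pose L := `|L'|; have L0 : 0 <= L by exact: normr_ge0.
have hA : \forall t \near (0 : R), forall i j, `|A t i j - A 0 i j| <= L * `|t|.
  apply: filterS hL' => t; rewrite subr0 => h i j.
  have := le_entry_norm (A t - A 0) i j; rewrite !mxE => /le_trans; apply.
  by apply: le_trans h _; rewrite ler_wpM2r ?ler_norm.
pose K0 := \sum_(i < n) \sum_(j < n) `|A 0 i j|.
have K00 : 0 <= K0 by apply: sumr_ge0 => i _; exact: sumr_ge0.
have hK0 i j : `|A 0 i j| <= K0.
  rewrite /K0 (bigD1 i)//= (bigD1 j)//= -addrA lerDl addr_ge0 ?sumr_ge0//.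
  by move=> k _; exact: sumr_ge0.
(* A bound for the entries of [A t] as long as [|t| <= 1]. *)
pose K := K0 + L.
have K_ge0 : 0 <= K by rewrite addr_ge0.
pose N := norm1 v.
have N0 : 0 <= N by exact: sumr_ge0.
exists ((L + K0 * n%:R * K) * (2 * N)).
have [r /= r0 hr] := hA.
near=> d => V V0 sol i.
have dr : `|d| < r.
  by near: d; exists r => //= e /=; rewrite sub0r normrN.
have d1 : `|d| <= 1.
  by near: d; exists 1 => //= e /=; rewrite sub0r normrN => /ltW.
have dK : 2 * (n%:R * K) * `|d| <= 1.
  near: d; exists (2 * (n%:R * K) + 1)^-1 => /=.
    by rewrite invr_gt0 ltr_wpDl ?mulr_ge0.
  move=> e /=; rewrite sub0r normrN => he.
  apply: le_trans (_ : (2 * (n%:R * K) + 1) * `|e| <= _).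
    by rewrite ler_wpM2r// lerDl.
  by rewrite -ler_pdivlMl ?ltr_wpDl ?mulr_ge0// mulr1 ltW.
have hAt t : `|t| <= `|d| -> forall i j, `|A t i j - A 0 i j| <= L * `|t|.
  by move=> td; apply: hr; rewrite /= sub0r normrN; exact: le_lt_trans dr.
have hAK t : `|t| <= `|d| -> forall i j, `|A t i j| <= K.
  move=> td k j; rewrite -(subrK (A 0 k j) (A t k j)).
  apply: le_trans (ler_normD _ _) _; rewrite /K addrC lerD//.
  apply: le_trans (hAt t td k j) _.
  by rewrite -[leRHS]mulr1 ler_wpM2l// (le_trans td).
have apriori := linear_ode_a_priori K_ge0 dK hAK sol.
rewrite V0 -/N in apriori.
have drift t j : Num.min 0 d <= t <= Num.max 0 d ->
    `|V t 0 j - v 0 j| <= K * (2 * N) * `|d|.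
  move=> t_in.
  have dev : `|V t 0 j - V 0 0 j - 0 * (t - 0)| <= K * (2 * N) * `|t - 0|.
    apply: (mean_value_deviation (f := fun s => V s 0 j)) => s hs.
    have s_in := between_trans t_in hs.
    have [dV eqV] := sol s s_in j; split => //.
    rewrite subr0 -normrN (addr0_eq eqV).
    apply: le_trans (norm_sum_mul_le _ K_ge0 _) _ => [k|].
      by apply: hAK; exact: between_norm.
    by apply: ler_wpM2l => //; exact: apriori.
  rewrite mul0r !subr0 V0 in dev; apply: (le_trans dev).
  by rewrite ler_wpM2l ?mulr_ge0 ?between_norm.
have dev : `|V d 0 i - V 0 0 i - - (\sum_(j < n) A 0 i j * v 0 j) * (d - 0)|
    <= (L + K0 * n%:R * K) * (2 * N) * `|d| * `|d - 0|.
  apply: (mean_value_deviation (f := fun s => V s 0 i)) => t t_in.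
  have [dV eqV] := sol t t_in i; split => //.
  rewrite opprK -normrN opprD (addr0_eq eqV).
  (* Separate the variation of the matrix from that of the solution. *)
  have -> : \sum_(j < n) A t i j * V t 0 j - \sum_(j < n) A 0 i j * v 0 j =
      \sum_(j < n) (A t i j - A 0 i j) * V t 0 j +
      \sum_(j < n) A 0 i j * (V t 0 j - v 0 j).
    by rewrite -sumrB -big_split /=; apply: eq_bigr => j _; ring.
  have td := between_norm t_in.
  apply: le_trans (ler_normD _ _) _.
  have -> : (L + K0 * n%:R * K) * (2 * N) * `|d| =
    L * `|d| * (2 * N) + K0 * (n%:R * (K * (2 * N) * `|d|)) by ring.
  apply: lerD.
    apply: le_trans (norm_sum_mul_le (K := L * `|d|) _ _ _) _ => [|j|].
    - by rewrite mulr_ge0.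
    - by apply: le_trans (hAt t td i j) _; rewrite ler_wpM2l.
    - by apply: ler_wpM2l; [rewrite mulr_ge0|exact: apriori].
  apply: le_trans (norm_sum_mul_le _ K00 (hK0 i)) _.
  by rewrite ler_wpM2l//; apply: ler_sum_const => j; exact: drift.
rewrite subr0 V0 in dev.
rewrite -[d ^+ 2]real_normK ?num_real// expr2 [leRHS]mulrA.
by move: dev; rewrite mulNr opprK [_ * d]mulrC.
Unshelve. all: by end_near. Qed.

(** * Parallel transport to first order *)

(** The matrix of the parallel transport equation along [y]. *)
Definition connection_matrix (R : realType) (n : nat) (M : smooth_manifold R n)
    (D : connection M) (c : chart R n M) (y : R -> M) (t : R) : 'M[R]_n :=
  \matrix_(i, j) \sum_(k < n) Gamma D c i j k (y t) * velocity c y t 0 k.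

(** Each [Gamma] is a component of the vector field obtained by differentiating
    one coordinate field along another. *)
Lemma connection_matrix_derivable (R : realType) (n : nat)
    (M : smooth_manifold R n) (D : connection M) (c : chart R n M)
    (I : set R) (y : R -> M) (t : R) :
  atlas c -> smooth_curve_in c I y -> I t ->
  derivable (connection_matrix D c y) t 1.
Proof.
move=> ac hy It; have [oI _ Iy _] := hy.
apply/derivable_mxP => i j.
pose h (k : 'I_n) (s : R) : R := Gamma D c i j k (y s) * velocity c y s 0 k.
have dh k : derivable (h k) t 1.
  have dG : derivable (fun s => Gamma D c i j k (y s)) t 1.
    have cf l := coord_field_vector_field l ac.
    have field := nabla_vector_field D (@chart_dom_open _ _ _ c) (cf k) (cf j).
    apply: (vector_field_derivable ac (@chart_dom_open _ _ _ c) field).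
    - exact: Iy.
    - by apply: filterS (open_nbhs_nbhs (conj oI It)) => s /Iy.
    - exact: smooth_curve_coord_differentiable hy It.
  have dv := velocity_derivable (k := k) hy It.
  exact: (derivableM dG dv).
apply: near_eq_derivable (derivable_sum dh).
by near=> s; rewrite mxE fct_sumE.
Unshelve. all: by end_near. Qed.

Lemma parallel_transport_first_order (R : realType) (n : nat)
    (M : smooth_manifold R n) (D : connection M) (c : chart R n M)
    (I : set R) (y : R -> M) (v : 'rV[R]_n) :
  atlas c -> smooth_curve_in c I y -> I 0 ->
  exists C : R, \forall d \near (0 : R), forall w : 'rV[R]_n,
    parallel_transport D c y 0 d v w -> forall i,
    `|w 0 i - v 0 i + d * \sum_(j < n) \sum_(k < n)
        Gamma D c i j k (y 0) * v 0 j * velocity c y 0 0 k| <= C * d ^+ 2.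
Proof.
move=> ac hy I0.
have entryE t (u : 'rV[R]_n) i :
    \sum_(j < n) connection_matrix D c y t i j * u 0 j =
    \sum_(j < n) \sum_(k < n) Gamma D c i j k (y t) * u 0 j * velocity c y t 0 k.
  apply: eq_bigr => j _; rewrite mxE mulr_suml.
  by apply: eq_bigr => k _; rewrite mulrAC.
have [C hC] :=
  linear_ode_first_order v (connection_matrix_derivable (D := D) ac hy I0).
exists C; apply: filterS hC => d hd w [V [hV V0 <-]] i.
rewrite -entryE; apply: hd => // t t_in j.
by rewrite entryE; exact: hV.
Qed.

Theorem corollary1 (R : realType) (n : nat) (M : smooth_manifold R n)
    (D Dstar : connection M) (hstar : transposed_connection D Dstar)
    (c : chart R n M) (hc : atlas c)
    (I It : set R) (x xt : R -> M)
    (hI0 : I 0) (hIt0 : It 0)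
    (hx : smooth_curve_in c I x) (hxt : smooth_curve_in c It xt)
    (hstart : x 0 = xt 0)
    (u ut : 'rV[R]_n)
    (hu : u = velocity c x 0) (hut : ut = velocity c xt 0)
    (u' ut' : R -> 'rV[R]_n)
    (hu' : \forall d \near (0 : R), parallel_transport D c xt 0 d u (u' d))
    (hut' : \forall d \near (0 : R),
       parallel_transport Dstar c x 0 d ut (ut' d)) :
  forall i : 'I_n,
    (fun d : R => (ut 0 i + u' d 0 i) - (u 0 i + ut' d 0 i))
      =O_ (0 : R) (fun d : R => d ^+ 2).
Proof.
move=> i.
have [C1 h1] := parallel_transport_first_order D u hc hxt hIt0.
have [C2 h2] := parallel_transport_first_order Dstar ut hc hx hI0.
apply/eqO_exP; exists (`|C1| + `|C2| + 1); first by rewrite ltr_wpDl.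
near=> d.
have b1 : `|u' d 0 i - u 0 i + d * \sum_(j < n) \sum_(k < n)
    Gamma D c i j k (xt 0) * u 0 j * velocity c xt 0 0 k| <= C1 * d ^+ 2.
  by apply: (near h1 d) => //; near: d.
have b2 : `|ut' d 0 i - ut 0 i + d * \sum_(j < n) \sum_(k < n)
    Gamma Dstar c i j k (x 0) * ut 0 j * velocity c x 0 0 k| <= C2 * d ^+ 2.
  by apply: (near h2 d) => //; near: d.
have x0c : chart_dom c (x 0) by have [_ _ + _] := hx; exact.
(* Transposing the coefficients makes the first-order terms agree. *)
have sumE : \sum_(j < n) \sum_(k < n)
      Gamma Dstar c i j k (x 0) * ut 0 j * velocity c x 0 0 k =
    \sum_(j < n) \sum_(k < n)
      Gamma D c i j k (xt 0) * u 0 j * velocity c xt 0 0 k.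
  rewrite exchange_big /= -hstart hu hut; apply: eq_bigr => j _.
  by apply: eq_bigr => k _; rewrite hstar// mulrAC.
rewrite sumE in b2; set S := \sum_(j < n) _ in b1 b2.
rewrite [`|d ^+ 2|]ger0_norm ?sqr_ge0//.
have -> : ut 0 i + u' d 0 i - (u 0 i + ut' d 0 i) =
  (u' d 0 i - u 0 i + d * S) - (ut' d 0 i - ut 0 i + d * S) by ring.
apply: le_trans (ler_normB _ _) _; apply: le_trans (lerD b1 b2) _.
rewrite -mulrDl ler_wpM2r ?sqr_ge0//.
apply: (le_trans (lerD (ler_norm C1) (ler_norm C2))).
by rewrite lerDl.
Unshelve. all: by end_near. Qed.
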